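(* Let $\varphi,\psi\in\mathcal W_{\mathbb H}$. Then $T_\varphi T_\psi$ is a Toeplitz operator (i.e. $T_\varphi T_\psi=T_g$ for some $g\in\mathcal W_{\mathbb H}$) if and only if $\varphi\in\mathcal W_{\mathbb H,-}$ or $\psi\in\mathcal W_{\mathbb H,+}$. In this case, $T_\varphi T_\psi=T_{\varphi\star\psi}$.
   Context: $\mathbb H$ is the real algebra of quaternions, $|\cdot|$ the quaternionic modulus, $\partial\mathbb B=\{p\in\mathbb H:|p|=1\}$. The quaternionic Wiener algebra $\mathcal W_{\mathbb H}$ consists of the functions $f(p)=\sum_{u\in\mathbb Z}p^uf_u$ with $f_u\in\mathbb H$ and $\sum_{u\in\mathbb Z}|f_u|<\infty$, with product $(f\star g)(p)=\sum_{u\in\mathbb Z}p^u\big(\sum_{k\in\mathbb Z}f_{u-k}g_k\big)$. $\mathcal W_{\mathbb H,+}$ (resp. $\mathcal W_{\mathbb H,-}$) is the subalgebra of those $f$ with $f_u=0$ for all $u<0$ (resp. for all $u>0$). $L_2(\partial\mathbb B)$ is the quaternionic Hilbert space of functions $f(p)=\sum_{n\in\mathbb Z}p^nf_n$ on $\partial\mathbb B$ (defined almost everywhere) with $f_n\in\mathbb H$ and $\|f\|^2=\sum_{n\in\mathbb Z}|f_n|^2<\infty$, with inner product $\langle f,g\rangle=\sum_{n}\overline{g_n}f_n$. $H_2(\partial\mathbb B)$ is the subspace of those $f$ with $f_n=0$ for $n<0$, and $\mathfrak p:L_2(\partial\mathbb B)\to H_2(\partial\mathbb B)$ is the orthogonal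 projection, $(\mathfrak pf)(p)=\sum_{n\ge0}p^nf_n$. For $\varphi\in\mathcal W_{\mathbb H}$, $M_\varphi f=\varphi\star f$ (the $\star$-product being again given by convolution of coefficients), and the Toeplitz operator $T_\varphi$ on $H_2(\partial\mathbb B)$ is $T_\varphi f=\mathfrak pM_\varphi f$. Equivalently, $T_\varphi$ acts on sequences $\xi=(\xi_n)_{n\ge0}\in\ell_2(\mathbb H)$ by $(T_\varphi\xi)_m=\sum_{n\ge0}\varphi_{m-n}\xi_n$. *)

(* Defs.v *)
From HB Require Import structures.
From mathcomp Require Import all_boot all_order all_algebra.
From mathcomp Require Import ring lra.
From mathcomp Require Import all_classical all_reals all_analysis.

Set Implicit Arguments.
Unset Strict Implicit.
Unset Printing Implicit Defensive.

Import Order.TTheory GRing.Theory Num.Theory.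
Import numFieldNormedType.Exports.

Local Open Scope classical_set_scope.
Local Open Scope ring_scope.

(* Quat a b c d stands for a + b i + c j + d k. *)
Record quat (R : Type) := Quat { q1 : R; qi : R; qj : R; qk : R }.

Section QuatAlgebra.
Variable R : realType.
Implicit Types x y z : quat R.

Definition quat_tuple x : R * R * R * R := (q1 x, qi x, qj x, qk x).
Definition tuple_quat (t : R * R * R * R) : quat R :=
  Quat t.1.1.1 t.1.1.2 t.1.2 t.2.

Lemma quat_tupleK : cancel quat_tuple tuple_quat.
Proof. by case. Qed.

HB.instance Definition _ := Choice.copy (quat R) (can_type quat_tupleK).

Definition quat_add x y :=
  Quat (q1 x + q1 y) (qi x + qi y) (qj x + qj y) (qk x + qk y).
Definition quat_opp x := Quat (- q1 x) (- qi x) (- qj x) (- qk x).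

Lemma quat_addA : associative quat_add.
Proof. by move=> x y z; rewrite /quat_add /= !addrA. Qed.

Lemma quat_addC : commutative quat_add.
Proof. by move=> x y; congr Quat; rewrite addrC. Qed.

Lemma quat_add0 : left_id (Quat 0 0 0 0) quat_add.
Proof. by case=> a b c d; rewrite /quat_add /= !add0r. Qed.

Lemma quat_addN : left_inverse (Quat 0 0 0 0) quat_opp quat_add.
Proof. by move=> x; rewrite /quat_add /= !addNr. Qed.

HB.instance Definition _ := GRing.isZmodule.Build (quat R)
  quat_addA quat_addC quat_add0 quat_addN.

Definition quat_mul x y :=
  Quat (q1 x * q1 y - qi x * qi y - qj x * qj y - qk x * qk y)
       (q1 x * qi y + qi x * q1 y + qj x * qk y - qk x * qj y)
       (q1 x * qj y - qi x * qk y + qj x * q1 y + qk x * qi y)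
       (q1 x * qk y + qi x * qj y - qj x * qi y + qk x * q1 y).

Lemma quat_mulA : associative quat_mul.
Proof. by move=> x y z; congr Quat => /=; ring. Qed.

Lemma quat_mul1 : left_id (Quat 1 0 0 0) quat_mul.
Proof. by case=> a b c d; congr Quat => /=; ring. Qed.

Lemma quat_mulr1 : right_id (Quat 1 0 0 0) quat_mul.
Proof. by case=> a b c d; congr Quat => /=; ring. Qed.

Lemma quat_mulDl : left_distributive quat_mul +%R.
Proof. by move=> x y z; congr Quat => /=; ring. Qed.

Lemma quat_mulDr : right_distributive quat_mul +%R.
Proof. by move=> x y z; congr Quat => /=; ring. Qed.

Lemma quat_1neq0 : Quat 1 0 0 0 != 0 :> quat R.
Proof. by apply/eqP => -[] /eqP; rewrite oner_eq0. Qed.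

HB.instance Definition _ := GRing.Zmodule_isNzRing.Build (quat R)
  quat_mulA quat_mul1 quat_mulr1 quat_mulDl quat_mulDr quat_1neq0.

Definition quat_sqn x : R := q1 x ^+ 2 + qi x ^+ 2 + qj x ^+ 2 + qk x ^+ 2.

Lemma quat_sqn_ge0 x : 0 <= quat_sqn x.
Proof. by rewrite !addr_ge0 ?sqr_ge0. Qed.

Lemma quat_sqn_eq0 x : (quat_sqn x == 0) = (x == 0).
Proof.
case: x => a b c d; rewrite /quat_sqn /=.
rewrite !paddr_eq0 ?addr_ge0 ?sqr_ge0 // !sqrf_eq0.
apply/idP/eqP => [/andP[/andP[/andP[/eqP-> /eqP->] /eqP->] /eqP->] //|].
by case=> -> -> -> ->; rewrite !eqxx.
Qed.

Definition quat_inv x :=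
  if x == 0 then 0 else
  Quat (q1 x / quat_sqn x) (- qi x / quat_sqn x)
       (- qj x / quat_sqn x) (- qk x / quat_sqn x).

Definition quat_unit : pred (quat R) := [pred x | x != 0].

Lemma quat_mulVr : {in quat_unit, left_inverse 1 quat_inv *%R}.
Proof.
move=> x x0; rewrite /quat_inv (negPf x0).
have n0 : quat_sqn x != 0 by rewrite quat_sqn_eq0.
rewrite /quat_sqn in n0 *.
by congr Quat => /=; field.
Qed.

Lemma quat_mulrV : {in quat_unit, right_inverse 1 quat_inv *%R}.
Proof.
move=> x x0; rewrite /quat_inv (negPf x0).
have n0 : quat_sqn x != 0 by rewrite quat_sqn_eq0.
rewrite /quat_sqn in n0 *.
by congr Quat => /=; field.
Qed.

Lemma quat_unitP x y : y * x = 1 /\ x * y = 1 -> quat_unit x.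
Proof.
move=> [yx _]; apply/eqP => x0.
by move/eqP: yx; rewrite x0 mulr0 eq_sym oner_eq0.
Qed.

Lemma quat_inv_out : {in [predC quat_unit], quat_inv =1 id}.
Proof. by move=> x; rewrite !inE negbK /quat_inv => /eqP ->; rewrite eqxx. Qed.

HB.instance Definition _ := GRing.NzRing_hasMulInverse.Build (quat R)
  quat_mulVr quat_mulrV quat_unitP quat_inv_out.

Definition quat_norm x : R := Num.sqrt (quat_sqn x).

Lemma quat_norm_triangle x y : quat_norm (x + y) <= quat_norm x + quat_norm y.
Proof.
rewrite /quat_norm -(@ler_pXn2r _ 2) ?nnegrE ?addr_ge0 ?sqrtr_ge0 //.
rewrite sqrrD !sqr_sqrtr ?quat_sqn_ge0 // -sqrtrM ?quat_sqn_ge0 //.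
set s := Num.sqrt _.
have : q1 x * q1 y + qi x * qi y + qj x * qj y + qk x * qk y <= s.
  apply: le_trans (ler_norm _) _; rewrite -sqrtr_sqr ler_wsqrtr //.
  rewrite -subr_ge0 /quat_sqn.
  have -> : (q1 x ^+ 2 + qi x ^+ 2 + qj x ^+ 2 + qk x ^+ 2) *
      (q1 y ^+ 2 + qi y ^+ 2 + qj y ^+ 2 + qk y ^+ 2) -
      (q1 x * q1 y + qi x * qi y + qj x * qj y + qk x * qk y) ^+ 2 =
      (q1 x * qi y - qi x * q1 y) ^+ 2 + (q1 x * qj y - qj x * q1 y) ^+ 2 +
      (q1 x * qk y - qk x * q1 y) ^+ 2 + (qi x * qj y - qj x * qi y) ^+ 2 +
      (qi x * qk y - qk x * qi y) ^+ 2 + (qj x * qk y - qk x * qj y) ^+ 2.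
    by ring.
  by rewrite !addr_ge0 ?sqr_ge0.
by rewrite /quat_sqn /= => ?; lra.
Qed.

Lemma quat_norm0_eq0 x : quat_norm x = 0 -> x = 0.
Proof.
move/eqP; rewrite sqrtr_eq0 => le0; apply/eqP.
by rewrite -quat_sqn_eq0 eq_le le0 quat_sqn_ge0.
Qed.

Lemma quat_normMn x n : quat_norm (x *+ n) = quat_norm x *+ n.
Proof.
have -> : x *+ n = Quat (q1 x *+ n) (qi x *+ n) (qj x *+ n) (qk x *+ n).
  by elim: n => [//|n IHn]; rewrite !mulrS IHn.
rewrite /quat_norm /quat_sqn /= !exprMn_n -!mulrnDl.
rewrite -mulr_natr natrX sqrtrM ?quat_sqn_ge0 //.
by rewrite sqrtr_sqr ger0_norm ?ler0n // mulr_natr.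
Qed.

Lemma quat_normN x : quat_norm (- x) = quat_norm x.
Proof. by rewrite /quat_norm /quat_sqn /= !sqrrN. Qed.

HB.instance Definition _ := Num.Zmodule_isNormed.Build R (quat R)
  quat_norm_triangle quat_norm0_eq0 quat_normMn quat_normN.

End QuatAlgebra.

Section Wiener.
Variable R : realType.

(* Limit of the symmetric partial sums over -N <= u <= N.  It is only used for
   absolutely convergent families, for which the order of summation is
   irrelevant. *)
Definition sumZ (a : int -> R) : R :=
  limn (fun N : nat => \sum_(k < N.*2.+1) a (k%:Z - N%:Z)).

Definition qsumZ (a : int -> quat R) : quat R :=
  Quat (sumZ (fun u => q1 (a u))) (sumZ (fun u => qi (a u)))
       (sumZ (fun u => qj (a u))) (sumZ (fun u => qk (a u))).

Definition qconv (a b : int -> quat R) (u : int) : quat R :=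
  qsumZ (fun k => a (u - k) * b k).

Definition qsphere := {p : quat R | `|p| == 1}.

(* Coefficients are on the right of the powers of the variable. *)
Definition qlaurent (c : int -> quat R) (p : qsphere) : quat R :=
  qsumZ (fun u => \val p ^ u * c u).

Definition wiener_expansion (f : qsphere -> quat R) (c : int -> quat R) :=
  (\esum_(u in [set: int]) (`|c u|)%:E < +oo)%E /\ f = qlaurent c.

Definition wiener : set (qsphere -> quat R) :=
  [set f | exists c, wiener_expansion f c].

(* The coefficients f_u of f in the Wiener algebra.  They are uniquely
   determined by f, so the choice made by xget is immaterial: restrict f to the
   circle of the unit complex numbers and average over roots of unity. *)
Definition wcoef (f : qsphere -> quat R) : int -> quat R :=
  xget (fun=> 0) (wiener_expansion f).

Definition wiener_plus : set (qsphere -> quat R) :=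
  [set f | wiener f /\ forall u : int, u < 0 -> wcoef f u = 0].

Definition wiener_minus : set (qsphere -> quat R) :=
  [set f | wiener f /\ forall u : int, 0 < u -> wcoef f u = 0].

Definition wstar (f g : qsphere -> quat R) : qsphere -> quat R :=
  qlaurent (qconv (wcoef f) (wcoef g)).

(* An element of L_2 of the sphere, a formal series \sum_n p^n f_n that is only
   meaningful almost everywhere, is represented by its coefficients (f_n). *)
Definition L2 : set (int -> quat R) :=
  [set f | (\esum_(n in [set: int]) (`|f n| ^+ 2)%:E < +oo)%E].

Definition H2 : set (int -> quat R) :=
  [set f | L2 f /\ forall n : int, n < 0 -> f n = 0].

Definition H2proj (f : int -> quat R) : int -> quat R :=
  fun n => if 0 <= n then f n else 0.

Definition wmult (phi : qsphere -> quat R) (f : int -> quat R) :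
  int -> quat R := qconv (wcoef phi) f.

Definition toeplitz (phi : qsphere -> quat R) (f : int -> quat R) :
  int -> quat R := H2proj (wmult phi f).

Definition eq_on_H2 (S T : (int -> quat R) -> (int -> quat R)) :=
  forall f, H2 f -> S f = T f.

Definition is_toeplitz (S : (int -> quat R) -> (int -> quat R)) :=
  exists2 g, wiener g & eq_on_H2 S (toeplitz g).

End Wiener.

(* Main.v *)
Require Import Defs.
From mathcomp Require Import all_boot all_order all_algebra.
From mathcomp Require Import ring lra zify.
From mathcomp Require Import all_classical all_reals all_analysis.

Set Implicit Arguments.
Unset Strict Implicit.
Unset Printing Implicit Defensive.

Import Order.TTheory GRing.Theory Num.Theory.
Import numFieldNormedType.Exports.

Local Open Scope classical_set_scope.
Local Open Scope ring_scope.

(** On the deltas at n >= 0 the product of the two Toeplitz operators has the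
    matrix entries sum_(k >= 0) phi_(m-k) psi_(k-n), and replacing (m, n) by
    (m+1, n+1) adds the term phi_(m+1) psi_(-n-1).  A Toeplitz matrix is constant
    along diagonals, so all these products vanish; since the quaternions have no
    zero divisors, phi_u = 0 for all u > 0 or psi_v = 0 for all v < 0.
    Conversely, either condition makes the projection between the two
    multiplications invisible, and associativity of the convolution applies.

    That phi * psi has the convolution as its coefficients requires uniqueness of
    absolutely summable expansions.  If sum_u p^u c_u vanishes on the circle of
    the unit complex numbers, then so do the series with coefficients c_(2u) and
    c_(u+m).  At p = 1 the sum of the c_(2^n u) is 0 for every n, and letting n
    tend to infinity leaves c_0 = 0. *)

(** * Absolute summability and sums of nonnegative families *)

Definition abs_summable (R : realType) (V : normedZmodType R) (T : choiceType)
    (a : T -> V) : Prop :=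
  (\esum_(x in [set: T]) (`|a x|)%:E < +oo)%E.

Lemma esumZl (R : realType) (T : choiceType) (k : R) (p : T -> R) :
  0 <= k -> (forall x, 0 <= p x) ->
  \esum_(x in [set: T]) (k * p x)%:E =
    (k%:E * \esum_(x in [set: T]) (p x)%:E)%E.
Proof.
move=> k0 p0; rewrite /esum -ereal_supZl //; last first.
  apply/set0P; exists 0%E; exists set0; first exact: fsets_set0.
  by rewrite fsbig_set0.
congr ereal_sup; rewrite [RHS]image_comp; apply: eq_imagel => F [finF _] /=.
by rewrite ge0_mule_fsumr // => x; rewrite lee_fin.
Qed.

Section NonnegativeSums.
Variables (R : realType) (T : choiceType).
Implicit Types p q : T -> R.

(** [fine] sends an infinite sum to 0, so this is the genuine sum only for summable [p]. *)
Definition nnsum p : R := fine (\esum_(x in [set: T]) (p x)%:E).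

Lemma nnsum_ge0 p : (forall x, 0 <= p x) -> 0 <= nnsum p.
Proof. by move=> p0; apply/fine_ge0/esum_ge0 => x _; rewrite lee_fin. Qed.

Lemma nnsumE p : (forall x, 0 <= p x) -> abs_summable p ->
  (nnsum p)%:E = \esum_(x in [set: T]) (p x)%:E.
Proof.
move=> p0 sp; rewrite /nnsum fineK // ge0_fin_numE.
  by under eq_esum do rewrite -[p _]ger0_norm //.
by apply: esum_ge0 => x _; rewrite lee_fin.
Qed.

Lemma nnsumD p q : (forall x, 0 <= p x) -> (forall x, 0 <= q x) ->
  abs_summable p -> abs_summable q ->
  nnsum (fun x => p x + q x) = nnsum p + nnsum q.
Proof.
move=> p0 q0 sp sq; rewrite {1}/nnsum.
under eq_esum do rewrite EFinD.
by rewrite esumD => [|x _|x _]; rewrite ?lee_fin // -!nnsumE.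
Qed.

Lemma nnsumZ k p : 0 <= k -> (forall x, 0 <= p x) -> abs_summable p ->
  nnsum (fun x => k * p x) = k * nnsum p.
Proof. by move=> k0 p0 sp; rewrite {1}/nnsum esumZl // -nnsumE. Qed.

Lemma nnsum_ext p q : p =1 q -> nnsum p = nnsum q.
Proof. by move=> /funext->. Qed.

Lemma le_nnsum p q : (forall x, 0 <= p x) -> (forall x, p x <= q x) ->
  abs_summable q -> nnsum p <= nnsum q.
Proof.
move=> p0 pq sq; have q0 x : 0 <= q x by exact: le_trans (pq x).
have sp : abs_summable p.
  by apply: le_lt_trans sq; apply: le_esum => x _; rewrite lee_fin !ger0_norm.
by rewrite -lee_fin !nnsumE //; apply: le_esum => x _; rewrite lee_fin.
Qed.

End NonnegativeSums.

Section AbsSummable.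
Variables (R : realType) (T : choiceType).

Lemma abs_summable_le (V W : normedZmodType R) (a : T -> V) (b : T -> W) :
  (forall x, `|a x| <= `|b x|) -> abs_summable b -> abs_summable a.
Proof.
by move=> ab; apply: le_lt_trans; apply: le_esum => x _; rewrite lee_fin.
Qed.

Lemma abs_summable_norm (V : normedZmodType R) (a : T -> V) :
  abs_summable a -> abs_summable (fun x => `|a x|).
Proof. by apply: abs_summable_le => x; rewrite normr_id. Qed.

Lemma abs_summableD (V : normedZmodType R) (a b : T -> V) :
  abs_summable a -> abs_summable b -> abs_summable (fun x => a x + b x).
Proof.
move=> sa sb; apply: (@le_lt_trans _ _
  (\esum_(x in [set: T]) ((`|a x|)%:E + (`|b x|)%:E))%E).
  by apply: le_esum => x _; rewrite -EFinD lee_fin ler_normD.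
by rewrite esumD // lte_add_pinfty.
Qed.

Lemma abs_summable_supp1 (V : normedZmodType R) (a : T -> V) x :
  (forall y, y != x -> a y = 0) -> abs_summable a.
Proof.
move=> a0; rewrite /abs_summable (_ : \esum_(y in _) _ = (`|a x|)%:E) ?ltry //.
rewrite -(@esum_set1 _ _ x (fun y => (`|a y|)%:E)) // [RHS]esum_mkcond.
apply: eq_esum => y _; case: ifPn => //.
by rewrite notin_setE /= => /eqP/a0 ->; rewrite normr0.
Qed.

(** A single term is the sum over a singleton. Wiener coefficients thereby count as bounded
    sequences in the convolution lemmas. *)
Lemma abs_summable_bounded (V : normedZmodType R) (a : T -> V) x :
  abs_summable a -> `|a x| <= nnsum (fun x => `|a x|).
Proof.
move=> sa; rewrite -lee_fin nnsumE //; last first.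
  by apply: abs_summable_le sa => y; rewrite normr_id.
rewrite -(@esum_set1 _ _ x (fun x => `|a x|%:E)) //.
by rewrite esum_mkcond; apply: le_esum => y _; case: ifP.
Qed.

Lemma abs_summableZ (V W : normedZmodType R) (k : R) (a : T -> V) (b : T -> W) :
  (forall x, `|b x| <= k * `|a x|) -> abs_summable a -> abs_summable b.
Proof.
(* The sign of [k] is unknown and [esumZl] wants a nonnegative factor, hence the maximum with 0. *)
move=> ba sa; have m0 : 0 <= Num.max k 0 by rewrite le_max lexx orbT.
have := @esumZl _ T (Num.max k 0) (fun x => `|a x|) m0 (fun x => normr_ge0 _).
move=> E; apply: (@le_lt_trans _ _
  ((Num.max k 0)%:E * \esum_(x in [set: T]) (`|a x|)%:E)%E).
  rewrite -E; apply: le_esum => x _; rewrite lee_fin (le_trans (ba x)) //.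
  by rewrite ler_wpM2r // le_max lexx.
by rewrite lte_mul_pinfty.
Qed.

End AbsSummable.

(** * Unordered sums of real families *)

Section SignedSums.
Variables (R : realType) (T : choiceType).
Implicit Types a b p q : T -> R.

(** Summing the positive and negative parts separately avoids any enumeration of [T], so reindexing
    and Fubini reduce to [esum]. *)
Definition asum a : R :=
  nnsum (fun x => Num.max (a x) 0) - nnsum (fun x => Num.max (- a x) 0).

Lemma abs_summable_pos a : abs_summable a ->
  abs_summable (fun x => Num.max (a x) 0).
Proof.
apply: abs_summable_le => x; rewrite ger0_norm ?le_max ?lexx ?orbT //.
by rewrite ge_max normr_ge0 ler_norm.
Qed.

Lemma abs_summable_neg a : abs_summable a ->
  abs_summable (fun x => Num.max (- a x) 0).
Proof.
move=> sa; apply: abs_summable_pos.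
by apply: abs_summable_le sa => x; rewrite normrN.
Qed.

Lemma max_pos_neg (r : R) : r = Num.max r 0 - Num.max (- r) 0.
Proof. by have [?|?] := leP r 0; have [?|?] := leP (- r) 0; lra. Qed.

Lemma norm_pos_neg (r : R) : `|r| = Num.max r 0 + Num.max (- r) 0.
Proof.
have [r0|r0] := leP r 0; last by rewrite max_r ?addr0 ?gtr0_norm //; lra.
by rewrite max_l ?add0r ?ler0_norm //; lra.
Qed.

(** From [a = p - q], the positive part of [a] plus [q] equals its negative part plus [p]; summing
    both sides gives the claim. Linearity and Fubini can then use whichever decomposition is at
    hand. *)
Lemma asumE a p q : abs_summable p -> abs_summable q ->
  (forall x, 0 <= p x) -> (forall x, 0 <= q x) ->
  (forall x, a x = p x - q x) -> asum a = nnsum p - nnsum q.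
Proof.
move=> sp sq p0 q0 apq.
have sa : abs_summable a.
  have -> : a = fun x => p x + - q x by apply/funext => x; rewrite apq.
  by apply: abs_summableD => //; apply: abs_summable_le sq => x; rewrite normrN.
have m0 (f : T -> R) x : 0 <= Num.max (f x) 0 by rewrite le_max lexx orbT.
have /eqP : nnsum (fun x => Num.max (a x) 0 + q x) =
            nnsum (fun x => Num.max (- a x) 0 + p x).
  apply: nnsum_ext => x; have := apq x; have := max_pos_neg (a x); lra.
rewrite !nnsumD //; try exact: (m0 (fun x => - a x)).
- by rewrite /asum => /eqP; lra.
- exact: abs_summable_neg.
- exact: abs_summable_pos.
Qed.

Lemma asumD a b : abs_summable a -> abs_summable b ->
  asum (fun x => a x + b x) = asum a + asum b.
Proof.
move=> sa sb; have m0 (f : T -> R) x : 0 <= Num.max (f x) 0.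
  by rewrite le_max lexx orbT.
rewrite (@asumE _ (fun x => Num.max (a x) 0 + Num.max (b x) 0)
                  (fun x => Num.max (- a x) 0 + Num.max (- b x) 0)).
- rewrite !nnsumD; try exact: abs_summable_pos; try exact: abs_summable_neg;
    try exact: m0; try exact: (m0 (fun x => - a x)); try exact: (m0 (fun x => - b x)).
  by rewrite /asum; lra.
- by apply: abs_summableD; exact: abs_summable_pos.
- by apply: abs_summableD; exact: abs_summable_neg.
- by move=> x; rewrite addr_ge0 // m0.
- by move=> x; rewrite addr_ge0 // (m0 (fun x => - _ x)).
- by move=> x; have := max_pos_neg (a x); have := max_pos_neg (b x); lra.
Qed.

Lemma asumN a : abs_summable a -> asum (fun x => - a x) = - asum a.
Proof.
move=> sa; rewrite /asum opprB; congr (_ - _); apply: nnsum_ext => x.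
by rewrite opprK.
Qed.

Lemma ler_norm_asum a : abs_summable a -> `|asum a| <= nnsum (fun x => `|a x|).
Proof.
move=> sa; have m0 (f : T -> R) x : 0 <= Num.max (f x) 0.
  by rewrite le_max lexx orbT.
have P0 := nnsum_ge0 (m0 a); have N0 := nnsum_ge0 (m0 (fun x => - a x)).
have -> : nnsum (fun x => `|a x|) =
    nnsum (fun x => Num.max (a x) 0) + nnsum (fun x => Num.max (- a x) 0).
  rewrite -nnsumD; try exact: m0; try exact: (m0 (fun x => - a x)).
  - by apply: nnsum_ext => x; rewrite norm_pos_neg.
  - exact: abs_summable_pos.
  - exact: abs_summable_neg.
by rewrite /asum ler_norml; apply/andP; split; lra.
Qed.

Lemma asumZ k a : abs_summable a -> asum (fun x => k * a x) = k * asum a.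
Proof.
have m0 (f : T -> R) x : 0 <= Num.max (f x) 0 by rewrite le_max lexx orbT.
(* A nonnegative factor preserves the positive and negative parts; a negative one is reduced to it
   through [asumN]. *)
have pos j b : 0 <= j -> abs_summable b -> asum (fun x => j * b x) = j * asum b.
  move=> j0 sb; rewrite (@asumE _ (fun x => j * Num.max (b x) 0)
                  (fun x => j * Num.max (- b x) 0)).
  - rewrite !nnsumZ // ?mulrBr //; try exact: (m0 (fun x => - b x)).
      exact: abs_summable_neg.
    exact: abs_summable_pos.
  - apply: (@abs_summableZ _ _ _ _ j _ _ _ (abs_summable_pos sb)) => x.
    by rewrite normrM (ger0_norm j0).
  - apply: (@abs_summableZ _ _ _ _ j _ _ _ (abs_summable_neg sb)) => x.
    by rewrite normrM (ger0_norm j0).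
  - by move=> x; rewrite mulr_ge0.
  - by move=> x; rewrite mulr_ge0 // (m0 (fun x => - b x)).
  - by move=> x; rewrite -mulrBr -max_pos_neg.
move=> sa; have [k0|k0] := leP 0 k; first exact: pos.
have -> : (fun x => k * a x) = fun x => - (- k * a x).
  by apply/funext => x; rewrite mulNr opprK.
rewrite asumN ?pos ?mulNr ?opprK //; first by rewrite oppr_ge0 ltW.
by apply: abs_summableZ sa => x; rewrite normrM.
Qed.

End SignedSums.

(** * Change of index along injections and bijections *)

Section Reindexing.
Variables (R : realType) (T T' : choiceType) (e : T -> T').
Hypothesis e_inj : injective e.

Lemma esum_inj (p : T' -> R) : (forall y, ~ range e y -> p y = 0) ->
  \esum_(y in [set: T']) (p y)%:E = \esum_(x in [set: T]) (p (e x))%:E.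
Proof.
move=> p0; rewrite -(@esum_image _ _ _ [set: T] e (fun y => (p y)%:E)); last first.
  by move=> x y _ _; exact: e_inj.
rewrite [RHS]esum_mkcond; apply: eq_esum => y _; case: ifPn => // /negP yN.
by rewrite p0 // => ry; apply: yN; rewrite inE.
Qed.

Lemma abs_summable_inj (V : normedZmodType R) (a : T' -> V) :
  abs_summable a -> abs_summable (fun x => a (e x)).
Proof.
apply: le_lt_trans.
rewrite -(@esum_image _ _ _ [set: T] e (fun y => (`|a y|)%:E)); last first.
  by move=> x y _ _; exact: e_inj.
by rewrite esum_mkcond; apply: le_esum => y _; case: ifP.
Qed.

Lemma le_nnsum_inj (p : T' -> R) : (forall y, 0 <= p y) -> abs_summable p ->
  nnsum (fun x => p (e x)) <= nnsum p.
Proof.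
move=> p0 sp; rewrite -lee_fin !nnsumE //; last exact: abs_summable_inj.
rewrite -(@esum_image _ _ _ [set: T] e (fun y => (p y)%:E)); last first.
  by move=> x y _ _; exact: e_inj.
by rewrite esum_mkcond; apply: le_esum => y _; case: ifP; rewrite lee_fin.
Qed.

Lemma asum_inj (a : T' -> R) : (forall y, ~ range e y -> a y = 0) ->
  asum a = asum (fun x => a (e x)).
Proof.
move=> a0; rewrite /asum; congr (_ - _); rewrite /nnsum; congr fine;
  by apply: esum_inj => y /a0 ->; rewrite ?oppr0 maxxx.
Qed.

End Reindexing.

Lemma asum_reindex (R : realType) (T T' : choiceType) (e : T -> T')
  (a : T' -> R) : bijective e -> asum a = asum (fun x => a (e x)).
Proof.
move=> [g ge eg]; apply: asum_inj; first exact: can_inj ge.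
by move=> y; case; exists (g y).
Qed.

(** * Double sums and exchange of summations *)

Section Fubini.
Variables (R : realType) (S T : choiceType).

Lemma esum_pair (p : S * T -> R) : (forall z, 0 <= p z) ->
  \esum_(x in [set: S]) \esum_(y in [set: T]) (p (x, y))%:E =
  \esum_(z in [set: S * T]) (p z)%:E.
Proof.
move=> p0; rewrite (@esum_esum _ _ _ setT (fun=> setT) (fun x y => (p (x, y))%:E)).
  have -> : [set: S] `*`` (fun=> [set: T]) = setT by apply/seteqP; split.
  by apply: eq_esum => -[].
by move=> i j _ _; rewrite lee_fin.
Qed.

Lemma abs_summable_row (V : normedZmodType R) (a : S * T -> V) x :
  abs_summable a -> abs_summable (fun y => a (x, y)).
Proof. by apply: abs_summable_inj => y y' []. Qed.

Lemma abs_summable_rows (V : normedZmodType R) (a : S * T -> V) :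
  abs_summable a -> abs_summable (fun x => nnsum (fun y => `|a (x, y)|)).
Proof.
move=> sa; have sr x : abs_summable (fun y => `|a (x, y)|).
  by apply: abs_summable_le (abs_summable_row x sa) => y; rewrite normr_id.
rewrite /abs_summable.
under eq_esum do rewrite ger0_norm ?nnsum_ge0 // nnsumE //.
by rewrite (esum_pair (fun z => normr_ge0 (a z))).
Qed.

Lemma nnsum_pair (p : S * T -> R) : (forall z, 0 <= p z) -> abs_summable p ->
  nnsum (fun x => nnsum (fun y => p (x, y))) = nnsum p.
Proof.
move=> p0 sp; rewrite {1}/nnsum /nnsum -(esum_pair p0); congr fine.
by apply: eq_esum => x _; rewrite nnsumE //; exact: abs_summable_row.
Qed.

Lemma abs_summable_asum (a : S * T -> R) : abs_summable a ->
  abs_summable (fun x => asum (fun y => a (x, y))).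
Proof.
move=> sa; apply: abs_summable_le (abs_summable_rows sa) => x.
rewrite [leRHS]ger0_norm ?nnsum_ge0 //; apply: ler_norm_asum.
exact: abs_summable_row.
Qed.

(** The row sums of the positive and negative parts of [a] decompose its row sums, so [asumE]
    reduces the claim to Tonelli for each part. *)
Lemma asum_pair (a : S * T -> R) : abs_summable a ->
  asum (fun x => asum (fun y => a (x, y))) = asum a.
Proof.
move=> sa; have m0 (f : S * T -> R) z : 0 <= Num.max (f z) 0.
  by rewrite le_max lexx orbT.
have rows (p : S * T -> R) : (forall z, 0 <= p z) -> abs_summable p ->
    abs_summable (fun x => nnsum (fun y => p (x, y))).
  move=> p0 sp; apply: abs_summable_le (abs_summable_rows sp) => x.
  by under [in leRHS]nnsum_ext do rewrite ger0_norm //.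
rewrite (@asumE _ _ _ (fun x => nnsum (fun y => Num.max (a (x, y)) 0))
                  (fun x => nnsum (fun y => Num.max (- a (x, y)) 0))) //.
- rewrite (nnsum_pair (m0 a)) ?(nnsum_pair (m0 (fun z => - a z))) //.
    exact: abs_summable_neg.
  exact: abs_summable_pos.
- by apply: (rows _ (m0 a)); exact: abs_summable_pos.
- by apply: (rows _ (m0 (fun z => - a z))); exact: abs_summable_neg.
- by move=> x; apply: nnsum_ge0 => y; exact: m0.
- by move=> x; apply: nnsum_ge0 => y; exact: (m0 (fun z => - a z)).
Qed.

(** By Tonelli, row [x] sums to the norm of [a x] times the total norm of [b], a finite number that
    factors out of the outer sum. *)
Lemma abs_summable_prod (V W : normedZmodType R) (a : S -> V) (b : T -> W) :
  abs_summable a -> abs_summable b ->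
  abs_summable (fun z : S * T => `|a z.1| * `|b z.2|).
Proof.
move=> sa sb; rewrite /abs_summable.
under eq_esum do rewrite ger0_norm ?mulr_ge0 //.
rewrite -esum_pair /=; last by move=> z; rewrite mulr_ge0.
under eq_esum do rewrite esumZl //.
have B : (\esum_(y in [set: T]) (`|b y|)%:E)%E \is a fin_num.
  by rewrite ge0_fin_numE // esum_ge0.
rewrite -(fineK B); under eq_esum do rewrite -EFinM mulrC.
rewrite esumZl ?lte_mul_pinfty //; last by apply/fine_ge0/esum_ge0.
by rewrite lee_fin; apply/fine_ge0/esum_ge0.
Qed.

End Fubini.

Lemma asum_exchange (R : realType) (S T : choiceType) (a : S * T -> R) :
  abs_summable a ->
  asum (fun x => asum (fun y => a (x, y))) =
  asum (fun y => asum (fun x => a (x, y))).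
Proof.
move=> sa; pose sw (z : T * S) := (z.2, z.1).
have swB : bijective sw by exists (fun z => (z.2, z.1)); case.
rewrite asum_pair // (asum_reindex a swB).
rewrite -(@asum_pair _ _ _ (fun z => a (sw z))) //.
by apply: (abs_summable_inj (bij_inj swB)).
Qed.

Lemma asum_supp1 (R : realType) (T : choiceType) (a : T -> R) x :
  (forall y, y != x -> a y = 0) -> asum a = a x.
Proof.
move=> a0; rewrite [RHS]max_pos_neg /asum.
have E (p : T -> R) : 0 <= p x -> (forall y, y != x -> p y = 0) -> nnsum p = p x.
  move=> px0 p0; apply: EFin_inj.
  have -> : nnsum p = fine (\esum_(y in [set x]) (p y)%:E).
    rewrite esum_mkcond /nnsum; congr fine; apply: eq_esum => y _.
    by case: ifPn; rewrite ?inE // notin_setE /= => /eqP/p0 ->.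
  by rewrite esum_set1 ?lee_fin // fineK.
by congr (_ - _); apply: E; rewrite ?le_max ?lexx ?orbT // => y /a0 ->;
  rewrite ?oppr0 maxxx.
Qed.

(** * Symmetric partial sums over the integers *)

Section SymmetricPartialSums.
Variable R : realType.

Definition psumZ (a : int -> R) (N : nat) := \sum_(k < N.*2.+1) a (k%:Z - N%:Z).

Let box N := [set u : int | (`|u| <= N)%N].

(** This turns a partial sum of [sumZ] into one of the finite sums whose supremum defines [esum]. *)
Let box_seq N : box N = [set` [seq k%:Z - N%:Z | k <- iota 0 N.*2.+1]].
Proof.
set r := map _ _; apply/seteqP; split => u; rewrite /box /=.
  move=> uN; apply/mapP; exists (absz (u + N%:Z)); last lia.
  by rewrite mem_iota; lia.
by case/mapP => k; rewrite mem_iota => kN ->; lia.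
Qed.

Let finite_box N : finite_set (box N).
Proof. by rewrite box_seq; exact: finite_seq. Qed.

Let psumZE (p : int -> R) N : (psumZ p N)%:E = \sum_(u \in box N) (p u)%:E.
Proof.
rewrite box_seq -fsbig_seq; last by rewrite map_inj_uniq ?iota_uniq // => x y; lia.
by rewrite big_map sumEFin /psumZ -(big_mkord xpredT (fun k => p (k%:Z - N%:Z))).
Qed.

Let finite_sub_box (A : set int) : finite_set A -> exists N, A `<=` box N.
Proof.
move=> /finite_seqP[s ->]; exists (\max_(u <- s) `|u|%N)%N => u /= us.
by apply: (@leq_bigmax_seq _ s xpredT (fun u => absz u)).
Qed.

Lemma psumZ_le_nnsum (p : int -> R) N : (forall u, 0 <= p u) ->
  abs_summable p -> psumZ p N <= nnsum p.
Proof.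
move=> p0 sp; rewrite -lee_fin psumZE nnsumE //; apply: ereal_sup_ubound.
by exists (box N) => //; split.
Qed.

(** The partial sums increase, and every finite set of integers lies in some box, so the supremum
    over boxes is the supremum over all finite sets. *)
Lemma nnsum_symmetric (p : int -> R) : (forall u, 0 <= p u) -> abs_summable p ->
  psumZ p @ \oo --> nnsum p.
Proof.
move=> p0 sp.
have le_nn N := psumZ_le_nnsum N p0 sp.
have nd : nondecreasing_seq (psumZ p).
  move=> m n mn; rewrite -lee_fin !psumZE; apply: lee_fsum_nneg_subset => //.
    by move=> u; rewrite !inE /box /= => /leq_trans; apply.
  by move=> u _; rewrite lee_fin.
have ub : has_ubound (range (psumZ p)) by exists (nnsum p) => _ [N _ <-].
suff <- : sup (range (psumZ p)) = nnsum p by exact: nondecreasing_cvgn.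
apply/le_anti/andP; split.
  by apply: ge_sup; [exists (psumZ p 0%N), 0%N|move=> _ [N _ <-]].
rewrite -lee_fin nnsumE //; apply: ge_ereal_sup => _ [A [finA _] <-].
have [N AN] := finite_sub_box finA.
apply: (@le_trans _ _ (psumZ p N)%:E).
  rewrite psumZE; apply: lee_fsum_nneg_subset => //.
    by move=> u; rewrite !inE => /AN.
  by move=> u _; rewrite lee_fin.
by rewrite lee_fin; apply: ub_le_sup => //; exists N.
Qed.

(** The tail [h] is the total minus the sum [l] inside the box, and the latter is at least the
    partial sum, which is within [eps] of the total. *)
Lemma nnsum_tail (p : int -> R) (eps : R) : (forall u, 0 <= p u) ->
  abs_summable p -> 0 < eps ->
  exists N, nnsum (fun u => if (N < `|u|)%N then p u else 0) <= eps.
Proof.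
move=> p0 sp e0; have /cvgrPdist_lt/(_ _ e0) [N _ near_N] := nnsum_symmetric p0 sp.
have {near_N} := near_N N (leqnn N); rewrite ltr_norml => /andP[_ pN]; exists N.
pose h u := if (N < `|u|)%N then p u else 0.
pose l u := if (N < `|u|)%N then 0 else p u.
have h0 u : 0 <= h u by rewrite /h; case: ifP.
have l0 u : 0 <= l u by rewrite /l; case: ifP.
have sh : abs_summable h.
  by apply: abs_summable_le sp => u; rewrite /h; case: ifP; rewrite ?normr0.
have sl : abs_summable l.
  by apply: abs_summable_le sp => u; rewrite /l; case: ifP; rewrite ?normr0.
have hl : nnsum p = nnsum h + nnsum l.
  rewrite -nnsumD //; apply: nnsum_ext => u; rewrite /h /l.
  by case: ifP; rewrite ?addr0 ?add0r.
have : psumZ p N = psumZ l N.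
  apply: eq_bigr => -[k kN] _; rewrite /l /= ifF //; lia.
have := psumZ_le_nnsum N l0 sl; rewrite -/h; lra.
Qed.

(** The bridge from the limit in [sumZ] to unordered sums. *)
Lemma sumZE (a : int -> R) : abs_summable a -> sumZ a = asum a.
Proof.
move=> sa; apply/cvg_lim => //.
rewrite (_ : (fun N : nat => _) = psumZ (fun u => Num.max (a u) 0) \-
                                  psumZ (fun u => Num.max (- a u) 0)).
  apply: cvgB; apply: nnsum_symmetric => [u|]; rewrite ?le_max ?lexx ?orbT //.
    exact: abs_summable_pos.
  exact: abs_summable_neg.
apply/funext => N /=; rewrite /psumZ -sumrB; apply: eq_bigr => k _.
exact: max_pos_neg.
Qed.

End SymmetricPartialSums.

(** * The quaternionic modulus *)

Section QuaternionNorm.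
Variable R : realType.
Implicit Types x y : quat R.

Lemma quat_normE x : `|x| = Num.sqrt (quat_sqn x).
Proof. by []. Qed.

(** Euler's four-square identity, checked by [ring]. *)
Lemma quat_normM x y : `|x * y| = `|x| * `|y|.
Proof.
rewrite !quat_normE -sqrtrM ?quat_sqn_ge0 //; congr Num.sqrt.
by rewrite /quat_sqn /=; ring.
Qed.

Lemma ler_norm_q1 x : `|q1 x| <= `|x|.
Proof.
rewrite quat_normE -sqrtr_sqr ler_wsqrtr // /quat_sqn.
by rewrite -!addrA lerDl !addr_ge0 ?sqr_ge0.
Qed.

Lemma ler_norm_qi x : `|qi x| <= `|x|.
Proof.
rewrite quat_normE -sqrtr_sqr ler_wsqrtr // /quat_sqn.
by have := (sqr_ge0 (q1 x), sqr_ge0 (qj x), sqr_ge0 (qk x)) => -[[]]; lra.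
Qed.

Lemma ler_norm_qj x : `|qj x| <= `|x|.
Proof.
rewrite quat_normE -sqrtr_sqr ler_wsqrtr // /quat_sqn.
by have := (sqr_ge0 (q1 x), sqr_ge0 (qi x), sqr_ge0 (qk x)) => -[[]]; lra.
Qed.

Lemma ler_norm_qk x : `|qk x| <= `|x|.
Proof.
rewrite quat_normE -sqrtr_sqr ler_wsqrtr // /quat_sqn.
by have := (sqr_ge0 (q1 x), sqr_ge0 (qi x), sqr_ge0 (qj x)) => -[[]]; lra.
Qed.

Lemma ler_quat_norm x : `|x| <= `|q1 x| + `|qi x| + `|qj x| + `|qk x|.
Proof.
rewrite quat_normE -(@ler_pXn2r _ 2) ?nnegrE ?addr_ge0 ?sqrtr_ge0 //.
rewrite sqr_sqrtr ?quat_sqn_ge0 // /quat_sqn -!(real_normK (num_real (_ x))).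
move: (normr_ge0 (q1 x)) (normr_ge0 (qi x)) (normr_ge0 (qj x)) (normr_ge0 (qk x)).
move: `|q1 x| `|qi x| `|qj x| `|qk x| => a b c d a0 b0 c0 d0; rewrite -subr_ge0.
have -> : (a + b + c + d) ^+ 2 - (a ^+ 2 + b ^+ 2 + c ^+ 2 + d ^+ 2) =
  2 * (a * b + a * c + a * d + b * c + b * d + c * d) by ring.
by rewrite mulr_ge0 ?addr_ge0 ?mulr_ge0.
Qed.

End QuaternionNorm.

(** * Unordered sums of quaternions *)

Section QuaternionSums.
Variables (R : realType) (T : choiceType).
Implicit Types (a b : T -> quat R) (c : quat R).

Definition qasum a : quat R :=
  Quat (asum (fun x => q1 (a x))) (asum (fun x => qi (a x)))
       (asum (fun x => qj (a x))) (asum (fun x => qk (a x))).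

Lemma abs_summable_q1 a : abs_summable a -> abs_summable (fun x => q1 (a x)).
Proof. by apply: abs_summable_le => x; exact: ler_norm_q1. Qed.

Lemma abs_summable_qi a : abs_summable a -> abs_summable (fun x => qi (a x)).
Proof. by apply: abs_summable_le => x; exact: ler_norm_qi. Qed.

Lemma abs_summable_qj a : abs_summable a -> abs_summable (fun x => qj (a x)).
Proof. by apply: abs_summable_le => x; exact: ler_norm_qj. Qed.

Lemma abs_summable_qk a : abs_summable a -> abs_summable (fun x => qk (a x)).
Proof. by apply: abs_summable_le => x; exact: ler_norm_qk. Qed.

Hint Resolve abs_summable_q1 abs_summable_qi abs_summable_qj abs_summable_qk : core.

Lemma abs_summable_quat a :
  abs_summable (fun x => q1 (a x)) -> abs_summable (fun x => qi (a x)) ->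
  abs_summable (fun x => qj (a x)) -> abs_summable (fun x => qk (a x)) ->
  abs_summable a.
Proof.
move=> /abs_summable_norm s1 /abs_summable_norm si.
move=> /abs_summable_norm sj /abs_summable_norm sk.
apply: abs_summable_le (abs_summableD (abs_summableD (abs_summableD s1 si) sj) sk).
by move=> x; rewrite [leRHS]ger0_norm ?addr_ge0 //; exact: ler_quat_norm.
Qed.

Lemma qasum_ext a b : a =1 b -> qasum a = qasum b.
Proof. by move=> /funext ->. Qed.

Lemma qasumD a b : abs_summable a -> abs_summable b ->
  qasum (fun x => a x + b x) = qasum a + qasum b.
Proof. by move=> sa sb; congr Quat; rewrite /= asumD; auto. Qed.

Lemma qasumN a : abs_summable a -> qasum (fun x => - a x) = - qasum a.
Proof. by move=> sa; congr Quat; rewrite /= asumN; auto. Qed.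

(** The shape of each component of a product with a fixed quaternion. *)
Lemma asum_lin4 (f g h l : T -> R) (k1 k2 k3 k4 : R) :
  abs_summable f -> abs_summable g -> abs_summable h -> abs_summable l ->
  asum (fun x => k1 * f x + k2 * g x + k3 * h x + k4 * l x) =
  k1 * asum f + k2 * asum g + k3 * asum h + k4 * asum l.
Proof.
move=> sf sg sh sl.
have Z k (p : T -> R) : abs_summable p -> abs_summable (fun x => k * p x).
  by move=> sp; apply: (@abs_summableZ _ _ _ _ `|k| _ _ _ sp) => x; rewrite normrM.
have := (Z k1 f sf, Z k2 g sg, Z k3 h sh, Z k4 l sl) => -[[[zf zg] zh] zl].
have zfg := abs_summableD zf zg; have zfgh := abs_summableD zfg zh.
by rewrite (asumD zfgh zl) (asumD zfg zh) (asumD zf zg) !asumZ.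
Qed.

(** Left multiplication by [c] is a real 4 by 4 matrix acting on the components, and each case below
    is one of its rows. Right multiplication has a different matrix, treated in [qasumMr]. *)
Lemma qasumMl a c : abs_summable a -> qasum (fun x => c * a x) = c * qasum a.
Proof.
move=> sa; have L := asum_lin4 _ _ _ _ (abs_summable_q1 sa) (abs_summable_qi sa)
  (abs_summable_qj sa) (abs_summable_qk sa).
congr Quat => /=.
- transitivity (asum (fun x => q1 c * q1 (a x) + (- qi c) * qi (a x) +
    (- qj c) * qj (a x) + (- qk c) * qk (a x))); last by rewrite L; ring.
  by congr asum; apply/funext => x; ring.
- transitivity (asum (fun x => qi c * q1 (a x) + q1 c * qi (a x) +
    (- qk c) * qj (a x) + qj c * qk (a x))); last by rewrite L; ring.
  by congr asum; apply/funext => x; ring.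
- transitivity (asum (fun x => qj c * q1 (a x) + qk c * qi (a x) +
    q1 c * qj (a x) + (- qi c) * qk (a x))); last by rewrite L; ring.
  by congr asum; apply/funext => x; ring.
- transitivity (asum (fun x => qk c * q1 (a x) + (- qj c) * qi (a x) +
    qi c * qj (a x) + q1 c * qk (a x))); last by rewrite L; ring.
  by congr asum; apply/funext => x; ring.
Qed.

Lemma qasumMr a c : abs_summable a -> qasum (fun x => a x * c) = qasum a * c.
Proof.
move=> sa; have L := asum_lin4 _ _ _ _ (abs_summable_q1 sa) (abs_summable_qi sa)
  (abs_summable_qj sa) (abs_summable_qk sa).
congr Quat => /=.
- transitivity (asum (fun x => q1 c * q1 (a x) + (- qi c) * qi (a x) +
    (- qj c) * qj (a x) + (- qk c) * qk (a x))); last by rewrite L; ring.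
  by congr asum; apply/funext => x; ring.
- transitivity (asum (fun x => qi c * q1 (a x) + q1 c * qi (a x) +
    qk c * qj (a x) + (- qj c) * qk (a x))); last by rewrite L; ring.
  by congr asum; apply/funext => x; ring.
- transitivity (asum (fun x => qj c * q1 (a x) + (- qk c) * qi (a x) +
    q1 c * qj (a x) + qi c * qk (a x))); last by rewrite L; ring.
  by congr asum; apply/funext => x; ring.
- transitivity (asum (fun x => qk c * q1 (a x) + qj c * qi (a x) +
    (- qi c) * qj (a x) + q1 c * qk (a x))); last by rewrite L; ring.
  by congr asum; apply/funext => x; ring.
Qed.

(** Each of the four components contributes at most the sum of the norms. The factor 4 is crude, but
    any constant suffices for the estimates below. *)
Lemma ler_norm_qasum a : abs_summable a ->
  `|qasum a| <= 4 * nnsum (fun x => `|a x|).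
Proof.
move=> sa; have sna := abs_summable_norm sa.
have B (f : T -> R) : (forall x, `|f x| <= `|a x|) ->
    `|asum f| <= nnsum (fun x => `|a x|).
  move=> fa; apply: le_trans (ler_norm_asum _) (le_nnsum _ _ _) => //.
  exact: abs_summable_le sa.
apply: (le_trans (ler_quat_norm _)) => /=.
have := B _ (fun x => ler_norm_q1 (a x)); have := B _ (fun x => ler_norm_qi (a x)).
have := B _ (fun x => ler_norm_qj (a x)); have := B _ (fun x => ler_norm_qk (a x)).
lra.
Qed.

Lemma qasum_supp1 a x : (forall y, y != x -> a y = 0) -> qasum a = a x.
Proof.
move=> a0; rewrite /qasum !(@asum_supp1 _ _ _ x); first by case: (a x).
all: by move=> y /a0 ->.
Qed.

End QuaternionSums.

Section QuaternionReindexing.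
Variables (R : realType) (S T : choiceType).

Lemma qasum_inj (e : S -> T) (a : T -> quat R) : injective e ->
  (forall y, ~ range e y -> a y = 0) -> qasum a = qasum (fun x => a (e x)).
Proof.
by move=> ei a0; congr Quat; apply: (asum_inj ei) => y /a0 ->.
Qed.

Lemma qasum_reindex (e : S -> T) (a : T -> quat R) : bijective e ->
  qasum a = qasum (fun x => a (e x)).
Proof. by move=> eb; congr Quat; exact: asum_reindex. Qed.

Lemma abs_summable_qasum (a : S * T -> quat R) : abs_summable a ->
  abs_summable (fun x => qasum (fun y => a (x, y))).
Proof.
move=> sa; apply: abs_summable_quat.
- exact: (abs_summable_asum (abs_summable_q1 sa)).
- exact: (abs_summable_asum (abs_summable_qi sa)).
- exact: (abs_summable_asum (abs_summable_qj sa)).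
- exact: (abs_summable_asum (abs_summable_qk sa)).
Qed.

Lemma qasum_exchange (a : S * T -> quat R) : abs_summable a ->
  qasum (fun x => qasum (fun y => a (x, y))) =
  qasum (fun y => qasum (fun x => a (x, y))).
Proof.
move=> sa; congr Quat.
- exact: (asum_exchange (abs_summable_q1 sa)).
- exact: (asum_exchange (abs_summable_qi sa)).
- exact: (asum_exchange (abs_summable_qj sa)).
- exact: (asum_exchange (abs_summable_qk sa)).
Qed.

End QuaternionReindexing.

Lemma qsumZE (R : realType) (a : int -> quat R) :
  abs_summable a -> qsumZ a = qasum a.
Proof.
move=> sa; congr Quat; apply: sumZE.
- exact: abs_summable_q1.
- exact: abs_summable_qi.
- exact: abs_summable_qj.
- exact: abs_summable_qk.
Qed.

(** * Convolution of a summable sequence with a bounded one *)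

Section Convolution.
Variable R : realType.
Implicit Types a b f : int -> quat R.

Lemma abs_summable_shift a m : abs_summable a -> abs_summable (fun k => a (m - k)).
Proof. by apply: abs_summable_inj => x y; lia. Qed.

(** Elements of [H2] are bounded but need not be summable, so only boundedness is asked of the right
    factor. *)
Lemma abs_summable_mulr_bounded (F : R) a f : (forall k, `|f k| <= F) ->
  abs_summable a -> abs_summable (fun k => a k * f k).
Proof.
move=> fF; apply: (@abs_summableZ _ _ _ _ F) => k.
by rewrite quat_normM mulrC ler_wpM2r.
Qed.

Lemma qconvE (F : R) a f u : (forall k, `|f k| <= F) -> abs_summable a ->
  qconv a f u = qasum (fun k => a (u - k) * f k).
Proof.
move=> fF sa; apply: qsumZE; apply: (abs_summable_mulr_bounded fF).
exact: abs_summable_shift.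
Qed.

Lemma bounded_qconv (F : R) a f : (forall k, `|f k| <= F) -> abs_summable a ->
  exists G : R, forall u, `|qconv a f u| <= G.
Proof.
move=> fF sa; exists (4 * (F * nnsum (fun k => `|a k|))) => u.
rewrite (qconvE _ fF) //; apply: le_trans (ler_norm_qasum _) _.
  by apply: (abs_summable_mulr_bounded fF); exact: abs_summable_shift.
have F0 : 0 <= F := le_trans (normr_ge0 _) (fF 0).
have sna := abs_summable_norm sa.
have snu := abs_summable_norm (abs_summable_shift u sa).
rewrite ler_pM2l //; apply: (@le_trans _ _ (F * nnsum (fun k => `|a (u - k)|))).
  rewrite -nnsumZ //; apply: le_nnsum => // [k|].
    by rewrite quat_normM mulrC ler_wpM2r.
  by apply: (@abs_summableZ _ _ _ _ F _ _ _ snu) => k; rewrite normrM (ger0_norm F0).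
rewrite ler_wpM2l //; apply: (@le_nnsum_inj _ _ _ (fun k => u - k) _ (fun k => `|a k|)) => //.
by move=> x y; lia.
Qed.

(** The map [(u, k) -> (u - k, k)] is injective, so the terms of all the convolutions form a
    reindexed part of the summable product family; its row sums are summable. *)
Lemma abs_summable_qconv a b : abs_summable a -> abs_summable b ->
  abs_summable (qconv a b).
Proof.
move=> sa sb; pose e (z : int * int) := (z.1 - z.2, z.2).
have ei : injective e by move=> [x y] [x' y'] [] *; congr (_, _); lia.
have -> : qconv a b = fun u => qasum (fun k => a (u - k) * b k).
  by apply/funext => u; apply: qconvE => // k; exact: abs_summable_bounded.
apply: (@abs_summable_qasum _ _ _ (fun z => a (z.1 - z.2) * b z.2)).
apply: abs_summable_le (abs_summable_inj ei (abs_summable_prod sa sb)) => z.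
by rewrite quat_normM ger0_norm ?mulr_ge0.
Qed.

(** The triple products [t] are dominated by [F] times a reindexed product family of [a] and [b],
    which justifies exchanging the sums although [f] is only bounded. *)
Lemma qconvA (F : R) a b f : abs_summable a -> abs_summable b ->
  (forall k, `|f k| <= F) -> qconv a (qconv b f) = qconv (qconv a b) f.
Proof.
move=> sa sb fF; apply/funext => m.
have F0 : 0 <= F := le_trans (normr_ge0 _) (fF 0).
have [G bfG] := bounded_qconv fF sb.
rewrite (qconvE _ bfG) // (qconvE _ fF); last exact: abs_summable_qconv.
pose t (z : int * int) := a (m - z.1) * b (z.1 - z.2) * f z.2.
have st : abs_summable t.
  pose e (z : int * int) := (m - z.1, z.1 - z.2).
  have ei : injective e by move=> [x y] [x' y'] [] *; congr (_, _); lia.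
  apply: (@abs_summableZ _ _ _ _ F _ _ _
    (abs_summable_inj ei (abs_summable_prod sa sb))) => z.
  rewrite !quat_normM (ger0_norm (mulr_ge0 _ _)) // mulrC.
  by rewrite ler_wpM2r ?mulr_ge0.
transitivity (qasum (fun n => qasum (fun k => t (n, k)))).
  apply: qasum_ext => n; rewrite (qconvE _ fF) // -qasumMl.
    by apply: qasum_ext => k; rewrite /t mulrA.
  by apply: (abs_summable_mulr_bounded fF); exact: abs_summable_shift.
rewrite qasum_exchange //; apply: qasum_ext => k.
have bB j : `|b j| <= nnsum (fun x => `|b x|) by exact: abs_summable_bounded.
rewrite (qconvE _ bB) // -qasumMr; last first.
  by apply: (abs_summable_mulr_bounded bB); exact: abs_summable_shift.
(* With [n = j + k] the inner sum becomes the convolution of [a] and [b] at [m - k]. *)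
rewrite (@qasum_reindex _ _ _ (fun j => j + k)); last first.
  by exists (fun j => j - k) => j; lia.
by apply: qasum_ext => j; rewrite /t /= addrK opprD addrA addrAC.
Qed.

End Convolution.

(** * Uniqueness of absolutely summable expansions *)

Section UniquenessOfCoefficients.
Variable R : realType.

(** The unit complex number [exp(i t)] inside the quaternions. *)
Definition cis (t : R) : quat R := Quat (cos t) (sin t) 0 0.

Lemma cisD s t : cis (s + t) = cis s * cis t.
Proof. by rewrite /cis cosD sinD; congr Quat => /=; ring. Qed.

Lemma cis0 : cis 0 = 1.
Proof. by rewrite /cis cos0 sin0. Qed.

Lemma cis_norm t : `|cis t| = 1.
Proof. by rewrite quat_normE /quat_sqn /= cos2Dsin2 expr0n /= !addr0 sqrtr1. Qed.

Lemma cis_unit t : cis t \is a GRing.unit.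
Proof. by change (cis t != 0); rewrite -normr_eq0 cis_norm oner_eq0. Qed.

Lemma cisV t : (cis t)^-1 = cis (- t).
Proof.
by apply: (mulrI (cis_unit t)); rewrite mulrV ?cis_unit // -cisD subrr cis0.
Qed.

Lemma cisX t (n : nat) : cis t ^+ n = cis (n%:R * t).
Proof.
elim: n => [|n IHn]; first by rewrite expr0 mul0r cis0.
by rewrite exprS IHn -cisD; congr cis; rewrite mulrS; ring.
Qed.

Lemma cisXz t (u : int) : cis t ^ u = cis (u%:~R * t).
Proof.
case: u => n; first by rewrite -exprnP cisX.
rewrite NegzE -exprnN cisX cisV; congr cis.
by rewrite mulrNz mulNr.
Qed.

Lemma cis_on_sphere t : `|cis t| == 1.
Proof. by rewrite cis_norm. Qed.

(** By [cisXz], [cis (u t)] is the power [p ^ u] at [p = cis t]; in this form the angle addition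
    formulas apply directly. *)
Definition null_on_circle (c : int -> quat R) : Prop :=
  abs_summable c /\ forall t, qasum (fun u => cis (u%:~R * t) * c u) = 0.

Lemma abs_summable_cis (c : int -> quat R) t :
  abs_summable c -> abs_summable (fun u => cis (u%:~R * t) * c u).
Proof.
by apply: abs_summable_le => u; rewrite quat_normM cis_norm mul1r.
Qed.

(** The coefficients stand to the right of the powers, so multiplying the series on the left by
    [p ^ (- m)] shifts the exponents and leaves the coefficients intact. *)
Lemma null_on_circle_shift c m :
  null_on_circle c -> null_on_circle (fun u => c (u + m)).
Proof.
move=> [sc c0]; split.
  by apply: (@abs_summable_inj _ _ _ (fun u => u + m)) sc => x y; lia.
move=> t; have := c0 t.
rewrite (@qasum_reindex _ _ _ (fun u => u + m)); last first.
  by exists (fun u => u - m) => u; lia.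
move/(congr1 (fun q => cis (- (m%:~R * t)) * q)); rewrite mulr0 -qasumMl.
  move=> E; rewrite -[RHS]E; apply: qasum_ext => u.
  by rewrite mulrA -cisD; congr (cis _ * _); rewrite intrD; ring.
apply: (@abs_summable_inj _ _ _ (fun u => u + m) _ _
   (fun u => cis (u%:~R * t) * c u)); first by move=> x y; lia.
exact: abs_summable_cis.
Qed.

(* Averaging the values at t/2 and t/2 + pi keeps the even powers only. *)
Lemma null_on_circle_double c :
  null_on_circle c -> null_on_circle (fun u => c (2 * u)).
Proof.
move=> [sc c0]; have ei : injective (fun u : int => 2 * u) by move=> x y; lia.
split; first exact: (abs_summable_inj ei).
move=> t; pose s := t / 2.
have ss := abs_summable_cis s sc; have sp := abs_summable_cis (s + pi) sc.
have Epi (w : int) : cis ((2 * w)%:~R * pi) = 1.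
  rewrite intrM mulrAC mulrC -cisXz.
  have -> : cis (2%:~R * pi) = 1; last by rewrite exp1rz.
  by rewrite /cis mulr_natl cos2pi sin2pi.
have even_odd (v : int) : cis (v%:~R * s) * c v + cis (v%:~R * (s + pi)) * c v =
    if (2 %| v)%Z then (cis (v%:~R * s) * c v) *+ 2 else 0.
  rewrite mulrDr cisD.
  case: ifP => [/dvdzP[w ->]|v2].
    by rewrite [w * 2]mulrC Epi mulr1 mulr2n.
  have [w ->] : exists w, v = 2 * w + 1 by exists (divz v 2); lia.
  have -> : cis ((2 * w + 1)%:~R * pi) = -1.
    rewrite intrD mulrDl cisD Epi !mul1r /cis cospi sinpi.
    by congr Quat; rewrite /= oppr0.
  by rewrite mulrN1 mulNr subrr.
have : qasum (fun v => if (2 %| v)%Z then (cis (v%:~R * s) * c v) *+ 2 else 0) = 0.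
  by rewrite -(qasum_ext even_odd) qasumD // !c0 addr0.
(* Only even indices survive, and they form the range of the injection [u -> 2 u]. *)
rewrite (qasum_inj ei); last first.
  move=> y yN; rewrite ifF //; apply/negP => /dvdzP[w yw]; apply: yN.
  by exists w; rewrite // yw mulrC.
set F := (X in qasum X = 0 -> _) => F0.
have : qasum F = qasum (fun u => cis (u%:~R * t) * c (2 * u)) *+ 2.
  rewrite mulr2n -qasumD; try by apply: abs_summable_cis; exact: (abs_summable_inj ei).
  apply: qasum_ext => u; rewrite /F dvdz_mulr // -mulr2n; congr ((cis _ * _) *+ 2).
  by rewrite intrM /s; field.
(* The factor 2 is cancelled in each real component. *)
rewrite F0 mulr2n; case: (qasum _) => x y z w [] X Y Z W.
by congr Quat; lra.
Qed.

Lemma null_on_circle_coef0 c : null_on_circle c -> c 0 = 0.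
Proof.
move=> nc; have sc := nc.1.
have nX n : null_on_circle (fun u => c (2 ^+ n * u)).
  elim: n => [|n [IH]]; first by under eq_fun do rewrite expr0 mul1r.
  move=> /(conj IH) /null_on_circle_double; congr null_on_circle.
  by apply/funext => u; rewrite mulrA exprSr.
apply/eqP; rewrite -normr_le0; apply/ler_addgt0Pl => eps e0; rewrite addr0.
have sn := abs_summable_norm sc.
(* The quarter absorbs the factor 4 of [ler_norm_qasum]. *)
have e4 : 0 < eps / 4 by rewrite divr_gt0.
have [N tailN] := nnsum_tail (fun u => normr_ge0 (c u)) sn e4.
(* One [N] serves both as cutoff of the tail and as number of doublings: for nonzero [u], the
   absolute value of [2 ^ N u] is at least [2 ^ N], which exceeds [N]. *)
pose e (u : int) := 2 ^+ N * u.
have ei : injective e by move=> x y; apply: mulfI; rewrite expf_neq0.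
(* At [t = 0] all powers are 1, so [c 0] is minus the sum of the [c (2 ^ N u)] over nonzero [u]. *)
have [se /(_ 0)] := nX N.
rewrite -(@qasum_ext _ _ (fun u => (if u == 0 then c 0 else 0) +
   (if u == 0 then 0 else c (e u)))); last first.
  move=> u; rewrite mulr0 cis0 mul1r /e.
  by case: eqVneq => [->|_]; rewrite ?mulr0 ?addr0 ?add0r.
rewrite qasumD; last 2 first.
- apply: (@abs_summable_le _ _ _ _ _ (fun u => c (e u))) => [u|].
    by rewrite /e; case: eqVneq => [->|_]; rewrite ?mulr0 ?normr0.
  exact: (abs_summable_inj ei).
- by apply: abs_summable_le se => u; case: eqVneq; rewrite ?normr0.
rewrite (@qasum_supp1 _ _ _ 0) ?eqxx; last by move=> y /negPf ->.
move/eqP; rewrite addr_eq0 => /eqP ->; rewrite normrN.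
have st : abs_summable (fun u => if u == 0 then 0 else c (e u)).
  by apply: abs_summable_le se => u; case: eqVneq; rewrite ?normr0.
apply: (le_trans (ler_norm_qasum st)).
pose h u := if (N < `|u|)%N then `|c u| else 0.
have h0 u : 0 <= h u by rewrite /h; case: ifP.
have sh : abs_summable h.
  by apply: abs_summable_le sn => u; rewrite /h; case: ifP; rewrite ?normr0.
suff : nnsum (fun u => `|if u == 0 then 0 else c (e u)|) <= nnsum h.
  by move: tailN; rewrite -/h; lra.
apply: le_trans (le_nnsum_inj ei h0 sh); apply: le_nnsum => //.
  move=> u; case: eqVneq => [->|u0]; first by rewrite normr0.
  rewrite /h ifT // /e abszM abszX.
  apply: leq_trans (ltn_expl N (ltnSn 1)) _; rewrite leq_pmulr //; lia.
exact: (abs_summable_inj ei).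
Qed.

Lemma null_on_circle_eq0 c : null_on_circle c -> forall u, c u = 0.
Proof.
by move=> nc u; have := null_on_circle_coef0 (null_on_circle_shift u nc); rewrite add0r.
Qed.

(** Comparing the two expansions at the points [cis t] of the sphere shows that [c - d] is null on
    the circle. *)
Lemma wiener_expansion_inj (f : qsphere R -> quat R) (c d : int -> quat R) :
  wiener_expansion f c -> wiener_expansion f d -> c = d.
Proof.
move=> [sc fc] [sd fd]; apply/funext => u; apply/eqP; rewrite -subr_eq0; apply/eqP.
have snd : abs_summable (fun u => - d u).
  by apply: abs_summable_le sd => v; rewrite normrN.
apply: (@null_on_circle_eq0 (fun u => c u - d u)); split => [|t].
  exact: abs_summableD.
have := congr1 (fun g => g (exist _ (cis t) (cis_on_sphere t))) (etrans (esym fc) fd).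
rewrite /qlaurent /=.
have E (a : int -> quat R) : abs_summable a ->
    qsumZ (fun u => cis t ^ u * a u) = qasum (fun u => cis (u%:~R * t) * a u).
  move=> sa; rewrite -qsumZE; last exact: abs_summable_cis.
  by congr qsumZ; apply/funext => v; rewrite cisXz.
rewrite !E // => /eqP; rewrite -subr_eq0 => /eqP <-.
have sct := abs_summable_cis t sc; have sdt := abs_summable_cis t sd.
have sdN : abs_summable (fun u => - (cis (u%:~R * t) * d u)).
  by apply: abs_summable_le sdt => v; rewrite normrN.
rewrite -(qasumN sdt) -(qasumD sct sdN).
by apply: qasum_ext => v; rewrite mulrBr.
Qed.

(** Uniqueness removes the choice made by [xget]. *)
Lemma wcoefE (f : qsphere R -> quat R) c : wiener_expansion f c -> wcoef f = c.
Proof.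
move=> fc; apply: (@wiener_expansion_inj f) => //.
exact: (@xgetI _ _ (wiener_expansion f) c).
Qed.

Lemma abs_summable_wcoef (f : qsphere R -> quat R) :
  wiener f -> abs_summable (wcoef f).
Proof. by move=> [c fc]; rewrite (wcoefE fc); case: fc. Qed.

End UniquenessOfCoefficients.

(** * Products of Toeplitz operators and their matrix entries *)

Section ToeplitzProducts.
Variable R : realType.
Implicit Types (phi psi : qsphere R -> quat R) (f : int -> quat R).

Lemma bounded_H2 f : H2 f -> exists F : R, forall k, `|f k| <= F.
Proof.
move=> [f2 _]; have sf : abs_summable (fun k => `|f k| ^+ 2 : R).
  rewrite /abs_summable; under eq_esum do rewrite ger0_norm ?exprn_ge0 //.
  exact: f2.
exists (1 + nnsum (fun k => `|(`|f k| ^+ 2 : R)|)) => k.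
have := abs_summable_bounded k sf; rewrite ger0_norm ?exprn_ge0 //.
(* The squares are bounded by their sum, and [x <= 1 + x ^ 2]. *)
by have := normr_ge0 (f k); nra.
Qed.

Lemma wiener_expansion_qlaurent (c : int -> quat R) :
  abs_summable c -> wiener_expansion (qlaurent c) c.
Proof. by []. Qed.

Lemma wcoef_wstar phi psi : wiener phi -> wiener psi ->
  wcoef (wstar phi psi) = qconv (wcoef phi) (wcoef psi).
Proof.
move=> wphi wpsi; apply/wcoefE/wiener_expansion_qlaurent.
by apply: abs_summable_qconv; exact: abs_summable_wcoef.
Qed.

Lemma wiener_wstar phi psi : wiener phi -> wiener psi -> wiener (wstar phi psi).
Proof.
move=> wphi wpsi; eexists; apply: wiener_expansion_qlaurent.
by apply: abs_summable_qconv; exact: abs_summable_wcoef.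
Qed.

Lemma qconv_eq0 (a f : int -> quat R) u :
  (forall k, a (u - k) * f k = 0) -> qconv a f u = 0.
Proof.
move=> af0; have s0 : abs_summable (fun k : int => a (u - k) * f k).
  exact: (@abs_summable_supp1 _ _ _ _ 0).
by rewrite /qconv qsumZE // (@qasum_supp1 _ _ _ 0) ?af0.
Qed.

Lemma toeplitz_mul phi psi : wiener phi -> wiener psi ->
  wiener_minus phi \/ wiener_plus psi ->
  eq_on_H2 (toeplitz phi \o toeplitz psi) (toeplitz (wstar phi psi)).
Proof.
move=> wphi wpsi phi_psi f Hf; have [F fF] := bounded_H2 Hf.
have [sa sb] := (abs_summable_wcoef wphi, abs_summable_wcoef wpsi).
apply/funext => m; rewrite /= /toeplitz /wmult wcoef_wstar // -(qconvA sa sb fF).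
rewrite /H2proj; case: ifP => // m0; congr qsumZ; apply/funext => n.
(* The projection only discards indices [n < 0]. As [m >= 0], the index [m - n] is then positive,
   where the coefficients of [phi] vanish in the first case. *)
case: ifPn => // n0; rewrite mulr0; case: phi_psi => -[_ h0].
  by rewrite h0 ?mul0r //; lia.
(* In the second case the discarded value is already 0: either [k < 0] and [f k = 0], or [n - k < 0]
   and the coefficient of [psi] vanishes. *)
rewrite qconv_eq0 ?mulr0 // => k; have [k0|k0] := ltP k 0.
  by rewrite Hf.2 ?mulr0.
by rewrite h0 ?mul0r //; lia.
Qed.

Definition qdelta (n : int) : int -> quat R := fun k => if k == n then 1 else 0.

Lemma H2_qdelta n : 0 <= n -> H2 (qdelta n).
Proof.
move=> n0; split=> [|k k0]; last by rewrite /qdelta ifF //; lia.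
rewrite /L2 /= (_ : \esum_(k in _) _ = (`|qdelta n n| ^+ 2)%:E) ?ltry //.
rewrite -(@esum_set1 _ _ n (fun k => (`|qdelta n k| ^+ 2)%:E)).
  rewrite [RHS]esum_mkcond; apply: eq_esum => k _; case: ifPn => //.
  by rewrite notin_setE /= => /eqP/negPf kn; rewrite /qdelta kn normr0 expr0n.
by rewrite lee_fin exprn_ge0.
Qed.

Lemma qconv_qdelta (a : int -> quat R) n u : abs_summable a ->
  qconv a (qdelta n) u = a (u - n).
Proof.
move=> sa; rewrite (@qconvE _ `|1 : quat R|) //; last first.
  by move=> k; rewrite /qdelta; case: ifP; rewrite ?normr0.
rewrite (@qasum_supp1 _ _ _ n); first by rewrite /qdelta eqxx mulr1.
by move=> k /negPf kn; rewrite /qdelta kn mulr0.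
Qed.

(* The matrix of [toeplitz phi \o toeplitz psi] on the basis of the [qdelta n]. *)
Definition toeplitz_mul_entry (a b : int -> quat R) (m n : int) : quat R :=
  qasum (fun k => if 0 <= k then a (m - k) * b (k - n) else 0).

Lemma toeplitz_mul_qdelta phi psi m n : wiener phi -> wiener psi ->
  0 <= m -> (toeplitz phi \o toeplitz psi) (qdelta n) m =
  toeplitz_mul_entry (wcoef phi) (wcoef psi) m n.
Proof.
move=> wphi wpsi m0.
have [sa sb] := (abs_summable_wcoef wphi, abs_summable_wcoef wpsi).
rewrite /= /toeplitz {1}/H2proj m0 /wmult.
(* The projected column consists of shifted coefficients of [psi] and zeros, hence is bounded by
   their total norm. *)
rewrite (@qconvE _ (nnsum (fun k => `|wcoef psi k|))) //; last first.
  move=> k; rewrite /H2proj; case: ifP => _.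
    by rewrite qconv_qdelta //; exact: abs_summable_bounded.
  by rewrite normr0 nnsum_ge0.
apply: qasum_ext => k; rewrite /H2proj; case: ifP; rewrite ?mulr0 //.
by rewrite qconv_qdelta.
Qed.

(** Substituting [k + 1] for [k] leaves the summand unchanged but starts the range at [k = -1]; that
    one extra term, carried by [d], is the product on the right. *)
Lemma toeplitz_mul_entryS (a b : int -> quat R) m n :
  abs_summable a -> abs_summable b ->
  toeplitz_mul_entry a b (m + 1) (n + 1) =
  a (m + 1) * b (- (n + 1)) + toeplitz_mul_entry a b m n.
Proof.
move=> sa sb; rewrite {1}/toeplitz_mul_entry.
rewrite (@qasum_reindex _ _ _ (fun k => k + 1)); last first.
  by exists (fun k => k - 1) => k; lia.
pose d (k : int) := if k == -1 then a (m + 1) * b (- (n + 1)) else 0.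
have sd : abs_summable d.
  apply: (@abs_summable_supp1 _ _ _ _ (-1)) => k /negPf k1; by rewrite /d k1.
have st : abs_summable (fun k => if 0 <= k then a (m - k) * b (k - n) else 0).
  apply: (@abs_summable_le _ _ _ _ _ (fun k => a (m - k) * b (k - n))) => [k|].
    by case: ifP; rewrite ?normr0.
  apply: (@abs_summable_mulr_bounded _ (nnsum (fun k => `|b k|))) => [k|].
    exact: abs_summable_bounded.
  exact: abs_summable_shift.
transitivity (qasum (fun k => d k + if 0 <= k then a (m - k) * b (k - n) else 0)).
  apply: qasum_ext => k; rewrite /d; have [->|k1] := eqVneq k (-1).
    by rewrite addNr lexx subr0 add0r [0 <= -1]lerNr oppr0 ler10 addr0.
  rewrite add0r; case: (leP 0 k) => k0; last by rewrite ifF //; lia.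
  by rewrite ifT; [congr (a _ * b _); lia|lia].
rewrite qasumD // (@qasum_supp1 _ _ d (-1)) ?/d ?eqxx // => k /negPf k1.
by rewrite k1.
Qed.

Lemma quat_mul_eq0 (x y : quat R) : x * y = 0 -> x = 0 \/ y = 0.
Proof.
move/(congr1 (fun q => `|q|)); rewrite quat_normM normr0 => /eqP.
by rewrite mulf_eq0 !normr_eq0 => /orP[] /eqP; [left|right].
Qed.

End ToeplitzProducts.

Theorem theorem3p1 (R : realType) (phi psi : qsphere R -> quat R)
    (hphi : wiener phi) (hpsi : wiener psi) :
  (is_toeplitz (toeplitz phi \o toeplitz psi) <->
     wiener_minus phi \/ wiener_plus psi) /\
  (wiener_minus phi \/ wiener_plus psi ->
     eq_on_H2 (toeplitz phi \o toeplitz psi) (toeplitz (wstar phi psi))).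
Proof.
split; last exact: toeplitz_mul; split; last first.
  move=> phi_psi; exists (wstar phi psi); first exact: wiener_wstar.
  exact: toeplitz_mul.
move=> [g wg Eg]; have sg := abs_summable_wcoef wg.
have [sa sb] := (abs_summable_wcoef hphi, abs_summable_wcoef hpsi).
have entry (m n : int) : 0 <= m -> 0 <= n ->
    toeplitz_mul_entry (wcoef phi) (wcoef psi) m n = wcoef g (m - n).
  move=> m0 n0; rewrite -toeplitz_mul_qdelta // (Eg _ (H2_qdelta _ n0)).
  by rewrite /toeplitz /H2proj m0 /wmult qconv_qdelta.
have ab0 (u v : int) : 0 < u -> v < 0 -> wcoef phi u * wcoef psi v = 0.
  (* The entries at [(u - 1, - v - 1)] and [(u, - v)] have nonnegative indices and lie on one
     diagonal. Both equal the same coefficient of [g], so the extra term is 0. *)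
  move=> u0 v0; have := toeplitz_mul_entryS (u - 1) (- v - 1) sa sb.
  rewrite !subrK opprK !entry; try lia.
  have -> : u - - v = u - 1 - (- v - 1) by lia.
  by rewrite -[LHS]add0r => /addIr/esym.
(* If some [u > 0] has a nonzero coefficient of [phi], this single [u] forces every coefficient of
   [psi] of negative index to vanish. *)
have [a0|] := pselect (forall u, 0 < u -> wcoef phi u = 0); first by left.
move=> /existsNP[u /not_implyP[u0 au]]; right; split => // v v0.
by have [] := quat_mul_eq0 (ab0 u v u0 v0).
Qed.
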